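(* Let $K \subseteq \mathbb{R}^n$ be a compact convex set with $K \subseteq R\,\mathbb{B}_1^n$ for some $R \in \mathbb{N}$, and let $\mathcal{T}$ be a branching proof of integer infeasibility for $K$. Then there exists a branching proof $\mathcal{T}'$ of integer infeasibility for $K$ such that $|\mathcal{T}'| \leq C\, n\, |\mathcal{T}|$ for an absolute constant $C$, every edge $e$ of $\mathcal{T}'$ is labeled by an inequality $\mathbf{a}'_e \mathbf{x} \leq b'_e$ with $\mathbf{a}'_e \in \mathbb{Z}^n$, $b'_e \in \mathbb{Z}$ and $$\max\{\|\mathbf{a}'_e\|_\infty, |b'_e|\} \leq (10nR)^{(n+2)^2},$$ and the bit-size satisfies $\langle \mathcal{T}' \rangle = O(n^3 \log_2(2nR)\, |\mathcal{T}|)$.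
   Context: $\mathbb{B}_1^n = \{\mathbf{x}\in\mathbb{R}^n : \|\mathbf{x}\|_1 \le 1\}$. A branching proof of integer infeasibility for a convex set $K\subseteq\mathbb{R}^n$ is a finite rooted tree $\mathcal{T}$ in which every internal node $v$ is labeled by a pair $(\mathbf{a}_v,b_v)\in\mathbb{Z}^n\times\mathbb{Z}$ and has exactly two children $v_l,v_r$; the edge $(v,v_l)$ is labeled with the inequality $\mathbf{a}_v\mathbf{x}\le b_v$ and the edge $(v,v_r)$ with $-\mathbf{a}_v\mathbf{x}\le -b_v-1$ (i.e. $\mathbf{a}_v\mathbf{x}\ge b_v+1$). For a node $v$, $K_v$ denotes $K$ intersected with all inequalities labeling the edges on the path from the root to $v$ (so $K_{\text{root}}=K$). $\mathcal{T}$ is valid if $K_v=\emptyset$ for every leaf $v$. The length $|\mathcal{T}|$ is the number of nodes. Bit-sizes: for a rational $r=p/q$ ($p,q\in\mathbb{Z}$, $q>0$, in lowest terms) $\langle r\rangle = 1+\lceil\log_2(|p|+1)\rceil+\lceil\log_2(q+1)\rceil$; for $\mathbf{c}\in\mathbb{Q}^n$, $\langle \mathbf{c}\rangle = n+\sum_i\langle c_i\rangle$; for a matrix, $\langle \mathsf{A}\rangle = mn+\sum_{i,j}\langle \mathsf{A}_{ij}\rangle$; $\langle A,B\rangle=\langle A\rangle+\langle B\rangle$. For a labeled rooted tree with node set $V$ and edge set $E$, $\langle\mathcal{T}\rangle = |V|+|E|+\sum_{e\in E}\langle L_e\rangle+\sum_{v\in V}\langle L_v\rangle$, where $L_e,L_v$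 are the edge and node labels (an inequality $\mathbf{a}\mathbf{x}\le b$ has bit-size $\langle \mathbf{a},b\rangle$). *)

(* Defs.v *)
From HB Require Import structures.
From mathcomp Require Import all_boot all_order all_algebra.
From mathcomp Require Import all_classical all_reals all_analysis.
Set Implicit Arguments. Unset Strict Implicit. Unset Printing Implicit Defensive.
Import Order.TTheory GRing.Theory Num.Theory.
Import numFieldNormedType.Exports.
Local Open Scope classical_set_scope.
Local Open Scope ring_scope.

Definition convexK (R : realType) (n : nat) (K : set 'rV[R]_n) : Prop :=
  forall x y (t : R), K x -> K y -> 0 <= t -> t <= 1 ->
    K (t *: x + (1 - t) *: y).

Definition l1norm (R : realType) (n : nat) (x : 'rV[R]_n) : R :=
  \sum_(i < n) `|x ord0 i|.

Definition iform (R : realType) (n : nat) (a : 'rV[int]_n) (x : 'rV[R]_n) : R :=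
  \sum_(i < n) (a ord0 i)%:~R * x ord0 i.

(* Branching trees: a leaf, or an internal node labeled by (a_v, b_v) with
   left child (edge a_v x <= b_v) and right child (edge -a_v x <= -b_v - 1). *)
Inductive btree (n : nat) : Type :=
| Leaf : btree n
| Node : 'rV[int]_n -> int -> btree n -> btree n -> btree n.
Arguments Leaf {n}.

Fixpoint valid (R : realType) (n : nat) (K : set 'rV[R]_n) (T : btree n) : Prop :=
  match T with
  | Leaf => K = set0
  | Node a b l r =>
      valid (K `&` [set x | iform a x <= b%:~R]) l /\
      valid (K `&` [set x | - iform a x <= (- b - 1)%:~R]) r
  end.

Fixpoint nnodes (n : nat) (T : btree n) : nat :=
  match T with Leaf => 1 | Node _ _ l r => (nnodes l + nnodes r).+1 end%N.

Fixpoint edge_labels (n : nat) (T : btree n) : seq ('rV[int]_n * int) :=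
  match T with
  | Leaf => [::]
  | Node a b l r => (a, b) :: (- a, - b - 1) :: edge_labels l ++ edge_labels r
  end.

(* bit-size of an integer p = p/1 : 1 + ceil(log2(|p|+1)) + ceil(log2(1+1)) *)
Definition bits_int (z : int) : nat := (1 + up_log 2 (`|z|%N + 1) + up_log 2 2)%N.
Definition bits_vec (n : nat) (a : 'rV[int]_n) : nat :=
  (n + \sum_(i < n) bits_int (a ord0 i))%N.
Definition bits_ineq (n : nat) (a : 'rV[int]_n) (b : int) : nat :=
  (bits_vec a + bits_int b)%N.

(* <T> = |V| + |E| + sum over edges of label sizes + sum over nodes of label sizes
   (leaves carry no label). *)
Fixpoint tbits (n : nat) (T : btree n) : nat :=
  match T with
  | Leaf => 1%N
  | Node a b l r =>
      (1 (* node *) + 2 (* its two child edges *) + bits_ineq a b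
       + bits_ineq a b + bits_ineq (- a) (- b - 1) + tbits l + tbits r)%N
  end.

Definition log2R (R : realType) (x : R) : R := ln x / ln 2.

(* Main.v *)
Require Import Defs.
From HB Require Import structures.
From mathcomp Require Import all_boot all_order all_algebra.
From mathcomp Require Import all_classical all_reals all_analysis.
From mathcomp Require Import zify ring lra.
Set Implicit Arguments.
Unset Strict Implicit.
Unset Printing Implicit Defensive.
Import Order.TTheory GRing.Theory Num.Theory.
Import numFieldNormedType.Exports.
Local Open Scope classical_set_scope.
Local Open Scope ring_scope.

(* Iterated simultaneous Diophantine approximation (Frank and Tardos) writes an affine
   form [a x - b] as a combination of integral forms [g_1, ..., g_k] with small
   coefficients and rapidly decreasing weights.  Recombining the [g_j] with powers of a
   moderate [M] as weights gives a small query [a' x <= b'], which replaces [a x <= b]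
   in the tree.  A leaf of the new tree may be nonempty, but there the original
   inequalities fail jointly while every [g_1] is at most slightly positive.  By Helly's
   theorem and averaging, some [g_1] exceeds -1 on the whole leaf region, so that two
   Chvatal-Gomory cuts force [g_1 = 0]; then [g_2] takes its place.  Each such round
   lowers the dimension, hence O(n) extra nodes per leaf suffice. *)

(** * Simultaneous Diophantine approximation *)

(** Pigeonhole on the fractional parts of the multiples [k * al]: two of them share a box of side
    1/N, and [q] is the difference of their indices. The entry at [i0] is an integer, its fractional
    parts are 0, and only [m - 1] coordinates need boxes. *)
Lemma dirichlet (R : realType) (m N : nat) (al : 'I_m -> R) (i0 : 'I_m) (z : int) :
  (0 < N)%N -> al i0 = z%:~R ->
  exists q : nat, exists p : 'I_m -> int,
    [/\ (0 < q)%N, (q <= N ^ m.-1)%N &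
        forall i, `|q%:R * al i - (p i)%:~R| < (N%:R)^-1].
Proof.
case: N => // N _ al0.
pose fr (k : nat) i : R := k%:R * al i - (Num.floor (k%:R * al i))%:~R.
have fr_ge0 k i : 0 <= fr k i by rewrite subr_ge0 floor_le.
have fr_lt1 k i : fr k i < 1.
  by rewrite ltrBlDl; have := floorD1_gt (k%:R * al i); rewrite intrD.
pose box k i : nat := `|Num.floor (N.+1%:R * fr k i)|%N.
have N0 : (0 : R) < N.+1%:R by rewrite ltr0n.
have boxE k i : (box k i)%:R = (Num.floor (N.+1%:R * fr k i))%:~R :> R.
  by rewrite natr_absz ger0_norm // floor_ge0 mulr_ge0 // ltW.
have box_lt k i : (box k i < N.+1)%N.
  rewrite -(ltr_nat R) boxE; apply: le_lt_trans (floor_le _) _.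
  by rewrite gtr_pMr.
pose F (k : 'I_(N.+1 ^ m.-1).+1) :=
  [ffun i : {i : 'I_m | i != i0} => inord (box k (val i)) : 'I_N.+1].
have ninjF : ~ injective F.
  move=> /leq_card; rewrite card_ord card_ffun card_ord card_sig.
  by rewrite (cardC1 i0) card_ord ltnn.
have [j [k /andP[jk /eqP FE]]] :
    exists j k : 'I_(N.+1 ^ m.-1).+1, (j < k)%N && (F j == F k).
  apply: contrapT => nex; apply: ninjF => x y Fxy; apply/val_inj/eqP.
  case: ltngtP => // h; exfalso; apply: nex; first by exists x, y; rewrite h Fxy /=.
  by exists y, x; rewrite h Fxy /=.
exists (k - j)%N,
  (fun i => Num.floor (k%:R * al i) - Num.floor (j%:R * al i)).
split; first by rewrite subn_gt0.
  by rewrite (leq_trans (leq_subr _ _)) // -ltnS.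
move=> i; have -> : (k - j)%:R * al i
    - (Num.floor (k%:R * al i) - Num.floor (j%:R * al i))%:~R = fr k i - fr j i.
  by rewrite /fr natrB 1?ltnW // intrB; ring.
have [->|ii0] := eqVneq i i0.
  have fr0 l : fr l i0 = 0.
    rewrite /fr al0 -[l%:R]/((Posz l)%:~R) -intrM intrKfloor; exact: subrr.
  by rewrite !fr0 subrr normr0 invr_gt0.
have boxjk : box j i = box k i.
  move/ffunP: FE => /(_ (exist _ i ii0)); rewrite !ffunE /= => /(congr1 val).
  by rewrite /= !inordK.
have fl l : (box l i)%:R <= N.+1%:R * fr l i < (box l i)%:R + 1.
  by rewrite boxE floor_le -intrD1 floorD1_gt.
rewrite -[X in _ < X]mulr1 -ltr_pdivrMl ?invr_gt0 // invrK.
rewrite -[X in X * _](gtr0_norm N0) -normrM mulrBr.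
move: (fl j) (fl k); rewrite boxjk => /andP[a1 a2] /andP[b1 b2].
by rewrite ltr_norml; apply/andP; split; lra.
Qed.

(** * Convex combinations and the theorems of Radon and Helly *)

(** Points of weight zero may lie outside [C], so the positive and the negative part of a Radon
    dependence can be summed over one common index set. *)
Lemma convexK_sum (R : realType) (n : nat) (C : set 'rV[R]_n) (I : finType)
    (c : I -> R) (x : I -> 'rV[R]_n) (s : seq I) :
  convexK C -> (forall i, i \in s -> 0 <= c i) ->
  (forall i, i \in s -> 0 < c i -> C (x i)) ->
  0 < \sum_(i <- s) c i ->
  C ((\sum_(i <- s) c i)^-1 *: \sum_(i <- s) c i *: x i).
Proof.
move=> cvC; elim: s => [|j s IH] c0 Cx; first by rewrite big_nil ltxx.
have c0' i : i \in s -> 0 <= c i by move=> si; apply: c0; rewrite inE si orbT.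
have Cx' i : i \in s -> 0 < c i -> C (x i).
  by move=> si; apply: Cx; rewrite inE si orbT.
rewrite !big_cons; set t := \sum_(i <- s) c i; set y := \sum_(i <- s) c i *: x i.
have t_ge0 : 0 <= t by rewrite /t big_seq sumr_ge0.
have cj0 : 0 <= c j by apply: c0; rewrite mem_head.
have [cj|cjN] := eqVneq (c j) 0.
  by rewrite cj scale0r !add0r; apply: IH.
have {cjN}cj1 : 0 < c j by rewrite lt_def cjN.
have Cj : C (x j) by apply: Cx; rewrite ?mem_head.
move=> s0; have [t0|t0] := eqVneq t 0.
  have -> : y = 0.
    rewrite /y big_seq big1 // => i si.
    move: t0 => /eqP; rewrite /t big_seq psumr_eq0; last by move=> k; apply: c0'.
    by move=> /allP /(_ _ si); rewrite si /= => /eqP ->; rewrite scale0r.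
  by rewrite t0 !addr0 scalerA mulVf ?scale1r // gt_eqF.
have t1 : 0 < t by rewrite lt_def t0.
have := cvC _ _ (c j / (c j + t)) Cj (IH c0' Cx' t1).
rewrite divr_ge0 ?(ltW s0) // ler_pdivrMr // mul1r lerDl t_ge0 => /(_ isT isT).
congr C; rewrite scalerDr !scalerA; congr (_ *: _ + _ *: _); first by rewrite mulrC.
by rewrite -/t; field; rewrite t0 gt_eqF.
Qed.

(** The rows [(1, x i)] live in dimension n + 1, so more than n + 1 of them are dependent. A nonzero
    dependence of total weight zero has a positive coefficient. *)
Lemma radon (R : realType) (n : nat) (I : finType) (A : {set I}) (x : I -> 'rV[R]_n) :
  (n.+1 < #|A|)%N ->
  exists c : I -> R, [/\ exists2 i, i \in A & 0 < c i,
    \sum_(i in A) c i = 0 & \sum_(i in A) c i *: x i = 0].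
Proof.
move=> An.
pose B : 'M[R]_(#|A|, 1 + n) := \matrix_(k < #|A|) row_mx 1 (x (enum_val k)).
have : kermx B != 0.
  rewrite -mxrank_eq0 mxrank_ker subn_eq0 -ltnNge.
  by apply: leq_ltn_trans (rank_leq_col _) _.
case/rowV0Pn => u /sub_kermxP uB u0.
have [e1 e2] : \sum_k u 0 k = 0 /\ \sum_k u 0 k *: x (enum_val k) = 0.
  split.
    have := congr1 (fun v : 'rV[R]_(1 + n) => v 0 (lshift n 0)) uB.
    rewrite /= mxE [in RHS]mxE => e; rewrite -[RHS]e; apply: eq_bigr => k _.
    by rewrite mxE row_mxEl mxE mulr1.
  apply/rowP => j; have := congr1 (fun v : 'rV[R]_(1 + n) => v 0 (rshift 1 j)) uB.
  rewrite /= mxE [in RHS]mxE => e; rewrite summxE [in RHS]mxE -[RHS]e.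
  by apply: eq_bigr => k _; rewrite [in RHS]mxE row_mxEr [in LHS]mxE.
have [i1 i1A] : exists i, i \in A by apply/card_gt0P; apply: leq_trans An.
pose c i := u 0 (enum_rank_in i1A i).
have cE k : c (enum_val k) = u 0 k by rewrite /c enum_valK_in.
have s1 : \sum_(i in A) c i = 0.
  by rewrite big_enum_val -[RHS]e1; apply: eq_bigr => k _; rewrite cE.
have s2 : \sum_(i in A) c i *: x i = 0.
  by rewrite big_enum_val -[RHS]e2; apply: eq_bigr => k _; rewrite cE.
have [[i iA ci]|nex] := pselect (exists2 i, i \in A & 0 < c i).
  by exists c; split=> //; exists i.
exfalso; move/eqP: u0; apply; apply/rowP => k; rewrite mxE -cE.
have c0 i : i \in A -> 0 <= - c i.
  by move=> iA; rewrite oppr_ge0 leNgt; apply/negP => ci; apply: nex; exists i.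
have : \sum_(i in A) - c i == 0 by rewrite sumrN s1 oppr0.
rewrite psumr_eq0 // => /allP /(_ (enum_val k)).
by rewrite mem_index_enum enum_valP oppr_eq0 => /(_ isT) /eqP.
Qed.

(** Induction on the size of [A]: for each [i], pick [x i] in all the other sets; the Radon point of
    these points lies in every set of [A]. *)
Lemma helly (R : realType) (n : nat) (I : finType) (C : I -> set 'rV[R]_n) :
  (forall i, convexK (C i)) ->
  (forall A : {set I}, (#|A| <= n.+1)%N -> exists x, forall i, i \in A -> C i x) ->
  exists x, forall i, C i x.
Proof.
move=> cvC small.
suff H m (A : {set I}) : #|A| = m -> exists x, forall i, i \in A -> C i x.
  by have [x xP] := H _ [set: I]%SET erefl; exists x => i; apply: xP; rewrite inE.
elim: m A => [|m IH] A Am; first by apply: small; rewrite Am.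
have [An|An] := leqP #|A| n.+1; first exact: small.
have /choice [x xP] i : exists x, i \in A -> forall k, k \in A :\ i -> C k x.
  have [iA|_] := boolP (i \in A); last by exists 0.
  have [|x xP] := IH (A :\ i); first by move: Am; rewrite (cardsD1 i) iA; case.
  by exists x.
have [c [[i0 i0A ci0] s1 s2]] := radon x An.
pose cp i := Num.max (c i) 0; pose cm i := Num.max (- c i) 0.
have cpE i : c i = cp i - cm i by rewrite /cp /cm /Num.max; case: ifP; case: ifP; lra.
have cp0 i : 0 <= cp i by rewrite le_max lexx orbT.
have cm0 i : 0 <= cm i by rewrite le_max lexx orbT.
have sp : \sum_(i <- enum A) cp i = \sum_(i <- enum A) cm i.
  apply/eqP; rewrite -subr_eq0 -sumrB big_enum /= -[X in _ == X]s1; apply/eqP.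
  by apply: eq_bigr => i _; rewrite cpE.
have sx : \sum_(i <- enum A) cp i *: x i = \sum_(i <- enum A) cm i *: x i.
  apply/eqP; rewrite -subr_eq0 -sumrB big_enum /= -[X in _ == X]s2; apply/eqP.
  by apply: eq_bigr => i _; rewrite cpE scalerBl.
have sgt0 : 0 < \sum_(i <- enum A) cp i.
  rewrite big_enum /= (bigD1 i0) //= ltr_wpDr ?sumr_ge0 //.
  by rewrite /cp lt_max ci0.
(* The Radon point is a convex combination of the [x i] with [c i > 0], and also of those with
   [c i < 0]. For each [k], the one that omits [x k] shows membership in [C k]. *)
exists ((\sum_(i <- enum A) cp i)^-1 *: \sum_(i <- enum A) cp i *: x i) => k kA.
have [ck|ck] := leP (c k) 0.
  apply: convexK_sum => // i; rewrite mem_enum => iA cpi; apply: xP => //.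
  rewrite !inE kA andbT; apply: contraTneq cpi => <-.
  by rewrite /cp (max_idPr ck) ltxx.
rewrite sx sp; apply: convexK_sum => //; last by rewrite -sp.
move=> i; rewrite mem_enum => iA cmi; apply: xP => //.
rewrite !inE kA andbT; apply: contraTneq cmi => <-.
by rewrite /cm max_r ?ltxx // oppr_le0 ltW.
Qed.

(** * Affine forms in homogeneous coordinates *)

Notation intv R v := (map_mx (intr : int -> R) v).

Definition hom (R : realType) (n : nat) (x : 'rV[R]_n) : 'rV[R]_(n + 1) :=
  row_mx x (const_mx (-1)).

(* The vector [(a, b)] stands for the affine form [x |-> a x - b]. *)
Definition aff (R : realType) (n : nat) (v : 'rV[R]_(n + 1)) (x : 'rV[R]_n) : R :=
  \sum_i v 0 i * hom x 0 i.

Section Aff.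
Context (R : realType) (n : nat).
Implicit Types (u v : 'rV[R]_(n + 1)) (x y : 'rV[R]_n).

Lemma affD u v x : aff (u + v) x = aff u x + aff v x.
Proof. by rewrite /aff -big_split; apply: eq_bigr => i _; rewrite mxE mulrDl. Qed.

Lemma affZ a v x : aff (a *: v) x = a * aff v x.
Proof. by rewrite /aff mulr_sumr; apply: eq_bigr => i _; rewrite mxE mulrA. Qed.

Lemma affB u v x : aff (u - v) x = aff u x - aff v x.
Proof. by rewrite affD -scaleN1r affZ mulN1r. Qed.

Lemma aff_intvZ (a : int) (p : 'rV[int]_(n + 1)) x :
  aff (intv R (a *: p)) x = a%:~R * aff (intv R p) x.
Proof.
by rewrite -affZ; congr aff; apply/rowP => i; rewrite !mxE intrM.
Qed.

Lemma aff_intvD (p q : 'rV[int]_(n + 1)) x :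
  aff (intv R (p + q)) x = aff (intv R p) x + aff (intv R q) x.
Proof. by rewrite map_mxD affD. Qed.

Lemma aff_intvB (p q : 'rV[int]_(n + 1)) x :
  aff (intv R (p - q)) x = aff (intv R p) x - aff (intv R q) x.
Proof. by rewrite map_mxB affB. Qed.

Lemma aff_row (a : 'rV[R]_n) (b : 'rV[R]_1) x :
  aff (row_mx a b) x = \sum_i a 0 i * x 0 i - b 0 0.
Proof.
rewrite /aff big_split_ord big_ord1 /= !row_mxEr mxE mulrN1.
by congr (_ - _); apply: eq_bigr => i _; rewrite !row_mxEl.
Qed.

Lemma aff_conv v x y t :
  aff v (t *: x + (1 - t) *: y) = t * aff v x + (1 - t) * aff v y.
Proof.
rewrite /aff !mulr_sumr -big_split; apply: eq_bigr => i _ /=.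
have -> : hom (t *: x + (1 - t) *: y) 0 i = t * hom x 0 i + (1 - t) * hom y 0 i.
  by case: (split_ordP i) => k ->; rewrite ?(row_mxEl, row_mxEr) !mxE; ring.
ring.
Qed.

Lemma aff_le v x c r :
  (forall i, `|v 0 i| <= c) -> l1norm x <= r -> `|aff v x| <= c * (r + 1).
Proof.
move=> vc xr.
have c0 : 0 <= c by apply: le_trans (vc (rshift n 0)).
apply: le_trans (ler_norm_sum _ _ _) _.
apply: (@le_trans _ _ (c * \sum_i `|hom x 0 i|)).
  by rewrite mulr_sumr ler_sum // => i _; rewrite normrM ler_wpM2r.
rewrite ler_wpM2l // big_split_ord big_ord1 /= row_mxEr mxE normrN1 lerD2r.
rewrite (eq_bigr (fun i => `|x ord0 i|)); first exact: xr.
by move=> i _; rewrite row_mxEl.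
Qed.

Lemma convexK_aff v c : convexK [set x | aff v x <= c].
Proof.
move=> x y t /= xc yc t0 t1; rewrite aff_conv.
have -> : c = t * c + (1 - t) * c by ring.
by rewrite lerD // ler_wpM2l // subr_ge0.
Qed.

Lemma convexKI (A B : set 'rV[R]_n) : convexK A -> convexK B -> convexK (A `&` B).
Proof. by move=> cA cB x y t [xA xB] [yA yB] t0 t1; split; [apply: cA|apply: cB]. Qed.
End Aff.

(** * Iterated approximation and its integral recombination *)

(* [chain N Lam w l] records an iterated simultaneous approximation
   [w = \sum la p + r] over the pairs [(la, p)] of [l], where the tail left after
   each [la p] is smaller than [la] by a factor [N]. *)
Fixpoint chain (R : realType) (m N : nat) (Lam : R) (w : 'rV[R]_m)
    (l : seq (R * 'rV[int]_m)) : Prop :=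
  match l with
  | [::] => forall i, `|w 0 i| <= Lam * (N ^ m.-1)%:R
  | (la, p) :: l' =>
      [/\ Lam <= la, forall i, (`|p ord0 i| <= N ^ m.-1)%N,
          forall i, `|(w - la *: intv R p) 0 i| <= la / N%:R
        & chain N Lam (w - la *: intv R p) l']
  end.

Lemma intr_norm_lt1 (R : realType) (z : int) : `|z%:~R| < 1 :> R -> z = 0.
Proof.
by rewrite -intr_norm -[1]/(1%:~R) ltr_int => h; lia.
Qed.

(** Each round applies [dirichlet] with the largest entry scaled to 1 or -1. The residue vanishes
    there and wherever [w] does, so the support shrinks. A round occurs only while some entry
    exceeds [Lam * N ^ m.-1]; as [q <= N ^ m.-1], this gives [Lam <= la]. *)
Lemma ex_chain (R : realType) (m N : nat) (Lam : R) (s : nat) (w : 'rV[R]_m) :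
  (0 < N)%N -> 0 < Lam -> (#|[pred i | w ord0 i != 0%R]| <= s)%N ->
  exists2 l, (size l <= s)%N & chain N Lam w l.
Proof.
move=> N0 Lam0; elim: s w => [|s IH] w ws.
  exists [::]; rewrite //= => i; have -> : w 0 i = 0.
    apply/eqP; apply: contraTT ws => wi; rewrite -ltnNge.
    by apply/card_gt0P; exists i.
  by rewrite normr0 mulr_ge0 ?ler0n ?ltW.
have [small|] := pselect (forall i, `|w 0 i| <= Lam * (N ^ m.-1)%:R).
  by exists [::].
move=> /existsNP[j0] /negP; rewrite -ltNge => wj0.
pose i0 := [arg max_(i > j0) `|w 0 i|]%O.
have wmax i : `|w 0 i| <= `|w 0 i0|.
  by rewrite /i0; case: arg_maxP => // k _ kmax; apply: kmax.
set om := `|w 0 i0| in wmax *.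
have omgt : Lam * (N ^ m.-1)%:R < om by apply: lt_le_trans (wmax j0).
have om0 : 0 < om by apply: le_lt_trans omgt; rewrite mulr_ge0 ?ler0n ?ltW.
have [|q [p [q0 qN qp]]] := @dirichlet R m N (fun i => w 0 i / om) i0
    (if 0 <= w 0 i0 then 1 else -1) N0.
  rewrite /om; have [w0|w0] := leP 0 (w 0 i0).
    by rewrite ger0_norm // divff // -normr_gt0.
  by rewrite ltr0_norm // invrN mulrN divff // -normr_gt0.
have qR : 0 < q%:R :> R by rewrite ltr0n.
have al1 i : `|w 0 i / om| <= 1.
  by rewrite normrM normfV [`|om|]gtr0_norm // ler_pdivrMr // mul1r.
have N1 : (N%:R)^-1 <= 1 :> R by rewrite invf_le1 ?ltr0n // ler1n.
pose la := om / q%:R.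
have la0 : 0 < la by rewrite divr_gt0.
pose pv := \row_i p i : 'rV[int]_m.
have res i : (w - la *: intv R pv) 0 i = la * (q%:R * (w 0 i / om) - (p i)%:~R).
  rewrite !mxE /la; field; by rewrite !gt_eqF.
have [|l ls lc] := IH (w - la *: intv R pv).
  rewrite -ltnS; apply: leq_trans ws; apply: proper_card.
  apply/properP; split; last first.
    exists i0; rewrite !inE; first by rewrite -normr_gt0.
    rewrite negbK res.
    (* This entry of the residue is [la] times an integer of absolute value below 1, hence 0. *)
    have := lt_le_trans (qp i0) N1.
    have -> : q%:R * (w 0 i0 / om) - (p i0)%:~R =
        (Posz q * (if 0 <= w 0 i0 then 1 else -1) - p i0)%:~R.
      rewrite intrB intrM; congr (_ * _ - _); rewrite /om.
      have [w0|w0] := leP 0 (w 0 i0).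
        by rewrite ger0_norm // divff // -normr_gt0.
      by rewrite ltr0_norm // invrN mulrN divff // -normr_gt0.
    by move=> /intr_norm_lt1 ->; rewrite mulr0.
  apply/fintype.subsetP => i; rewrite !inE; apply: contraNN => /eqP wi.
  rewrite res wi mul0r mulr0 sub0r; have := lt_le_trans (qp i) N1.
  by rewrite wi mul0r mulr0 sub0r normrN => /intr_norm_lt1 ->; rewrite oppr0 mulr0.
exists ((la, pv) :: l) => //=; split=> //.
- rewrite /la ler_pdivlMr //; apply: le_trans (ltW omgt).
  by rewrite ler_pM2l // ler_nat.
- move=> i; rewrite mxE; apply: leq_trans qN.
  have : `|(p i)%:~R| < (q.+1)%:R :> R.
    rewrite -natr1 -[(p i)%:~R](subKr (q%:R * (w 0 i / om))).
    apply: le_lt_trans (ler_normB _ _) _.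
    apply: ler_ltD; last exact: lt_le_trans (qp i) N1.
    rewrite normrM (ger0_norm (ltW qR)) -[X in _ <= X]mulr1.
    by rewrite ler_pM2l.
  by rewrite -intr_norm -[X in _ < X]/(Posz q.+1)%:~R ltr_int => h; lia.
- move=> i; rewrite res normrM gtr0_norm // ler_pM2l //; exact/ltW/qp.
Qed.

(* Rounding the coefficients of the approximation down to integers keeps the residue
   integral, and still equal to the original form where all the approximants vanish. *)
Fixpoint red (R : realType) (m : nat) (v : 'rV[int]_m) (l : seq (R * 'rV[int]_m)) :=
  match l with
  | [::] => v
  | (la, p) :: l' => red (v - Num.floor la *: p) l'
  end.

(** [c] is the accumulated rounding error in units of [N ^ m.-1]. Each floor is off by less than 1
    and multiplies a [p] with entries of at most one unit, so each approximant adds 1; the final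
    tail adds [Lam]. *)
Lemma red_le (R : realType) (m N : nat) (Lam c : R) (l : seq (R * 'rV[int]_m))
    (u : 'rV[R]_m) (v : 'rV[int]_m) :
  (forall i, `|(intv R v - u) 0 i| <= c * (N ^ m.-1)%:R) -> chain N Lam u l ->
  forall i, `|(red v l 0 i)%:~R| <= (Lam + c + (size l)%:R) * (N ^ m.-1)%:R.
Proof.
elim: l u v c => [|[la p] l IH] u v c vu /=.
  move=> ule i; rewrite addr0 mulrDl addrC.
  rewrite (_ : (v 0 i)%:~R = (intv R v - u) 0 i + u 0 i); last first.
    by rewrite !mxE subrK.
  by apply: le_trans (ler_normD _ _) _; rewrite lerD.
case=> laL pN _ lc i.
have -> : Lam + c + (size l).+1%:R = Lam + (c + 1) + (size l)%:R.
  by rewrite -natr1; ring.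
apply: IH lc i => i; rewrite [X in `|X|](_ : _ =
    (intv R v - u) 0 i + (la - (Num.floor la)%:~R) * (p 0 i)%:~R); last first.
  by rewrite !mxE intrB intrM; ring.
apply: le_trans (ler_normD _ _) _; rewrite [X in _ <= X]mulrDl mul1r lerD //.
rewrite normrM ger0_norm ?subr_ge0 ?floor_le // -[X in _ <= X]mul1r ler_pM //.
- by rewrite subr_ge0 floor_le.
- by rewrite lerBlDl -intrD1 ltW // floorD1_gt.
- by rewrite -intr_norm -natr_absz ler_nat.
Qed.

(* [M] exceeds all values taken by the forms on the ball, so the sign of [comb M l last]
   at an integer point is decided lexicographically. *)
Fixpoint comb (R : realType) (m M : nat) (l : seq (R * 'rV[int]_m)) (last : 'rV[int]_m) :=
  match l with
  | [::] => last
  | (la, p) :: l' => (M ^ (size l').+1)%N%:Z *: p + comb M l' last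
  end.

Lemma comb_le (R : realType) (m N M K P : nat) (Lam : R) (l : seq (R * 'rV[int]_m))
    (u : 'rV[R]_m) (last : 'rV[int]_m) :
  M = (K * P).+1 -> (N ^ m.-1 <= P)%N -> chain N Lam u l ->
  (forall i, (`|last ord0 i| <= P)%N) ->
  forall i, (`|comb M l last ord0 i| * K < M ^ (size l).+1)%N.
Proof.
move=> ME NP + lastP; elim: l u => [|[la p] l IH] u /=.
  by move=> _ i; rewrite expn1 ME ltnS mulnC leq_mul.
case=> _ pN _ lc i; rewrite !mxE.
have := IH _ lc i; have := leq_trans (pN i) NP.
move: (comb _ _ _ _ _) (p _ _) => y z zP yM.
have : (`|((M ^ (size l).+1)%N%:Z * z + y)%R| <= M ^ (size l).+1 * P + `|y|)%N.
  have /(leq_mul (leqnn (M ^ (size l).+1))) := zP.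
  by rewrite -[X in (X * `|z|)%N]absz_nat -abszM; lia.
rewrite [(M ^ (size l).+2)%N]expnS [X in (X * M ^ _)%N]ME; nia.
Qed.

(** * Lexicographic implication of the original inequality *)

(* Along [gs], each form is at most [dl] where the previous ones vanish, and either
   falling below [-th] or the vanishing of the whole of [gs] forces membership in [O]. *)
Fixpoint lex_implies (R : realType) (n P : nat) (dl th : R) (gs : seq 'rV[int]_(n + 1))
    (S O : set 'rV[R]_n) : Prop :=
  match gs with
  | [::] => S `<=` O
  | g :: gs' =>
      [/\ forall i, (`|g ord0 i| <= P)%N,
          forall x, S x -> aff (intv R g) x <= dl,
          forall x, S x -> aff (intv R g) x <= - th -> O x
        & lex_implies P dl th gs' (S `&` [set x | aff (intv R g) x = 0]) O]
  end.

Lemma lex_implies_sub (R : realType) (n P : nat) (dl th : R) (gs : seq 'rV[int]_(n + 1))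
    (S S' O : set 'rV[R]_n) :
  S' `<=` S -> lex_implies P dl th gs S O -> lex_implies P dl th gs S' O.
Proof.
elim: gs S S' => [|g gs IH] S S' SS' /=; first exact: subset_trans.
case=> gP gd gt gl; split=> // [x /SS'|x /SS'|]; [exact: gd|exact: gt|].
by apply: IH gl; apply: setSI.
Qed.

(** [sg = 1, c = 0] serves the left branch, [sg = -1, c = 1] the right one. In the query, the tail
    weighs at most [dl] relative to the leading power of [M], so the head form is at most [dl]. In
    [u], the leading weight is at least [Lam] and dominates the tail, so a head below [-th] forces
    the original inequality. *)
Lemma comb_lex (R : realType) (n N M K P : nat) (Lam dl th r sg c : R) (sz : int)
    (S O : set 'rV[R]_n)
    (l : seq (R * 'rV[int]_(n + 1))) (u : 'rV[R]_(n + 1)) (v : 'rV[int]_(n + 1)) :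
  sg = sz%:~R -> `|sz|%N = 1%N -> (0 < N)%N -> (0 < K)%N -> M = (K * P).+1 ->
  (N ^ (n + 1).-1 <= P)%N ->
  0 <= c -> (r + 1) / K%:R <= dl -> 0 < Lam ->
  c <= Lam * (th - (r + 1) / N%:R) -> 0 <= th - (r + 1) / N%:R ->
  (forall i, (`|red v l ord0 i| <= P)%N) -> chain N Lam u l ->
  (forall x, S x -> l1norm x <= r) ->
  (forall x, S x -> sg * aff (intv R (comb M l (red v l))) x <= - c) ->
  (forall x, S x -> aff (intv R v) x = aff u x) ->
  (forall x, S x -> sg * aff u x <= - c -> O x) ->
  lex_implies P dl th [seq sz *: e.2 | e <- l] S O.
Proof.
move=> sgE sz1 N0 K0 ME NP c0 Kdl Lam0 cLam thN.
have sg1 : `|sg| = 1 by rewrite sgE -intr_norm -abszE sz1.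
elim: l S u v => [|[la p] l IH] S u v /= lastP.
  by move=> _ _ Sc uv SO x Sx; apply: SO => //; rewrite -uv //; apply: Sc.
case=> laL pN resN lc Sr Sc uv SO.
have la0 : 0 < la by apply: lt_le_trans laL.
have M0 : 0 < (M ^ (size l).+1)%:R :> R by rewrite ltr0n expn_gt0 ME.
have KR : 0 < K%:R :> R by rewrite ltr0n.
have tail x : S x -> aff u x = la * aff (intv R p) x + aff (u - la *: intv R p) x.
  by move=> _; rewrite affB affZ; ring.
split.
- by move=> i; rewrite !mxE abszM sz1 mul1n (leq_trans (pN i)).
- move=> x Sx; rewrite aff_intvZ -sgE.
  have := Sc x Sx; rewrite aff_intvD aff_intvZ mulrDr.
  set cl := comb _ _ _ => H.
  have clb : `|aff (intv R cl) x| <= (M ^ (size l).+1)%:R / K%:R * (r + 1).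
    apply: aff_le; last exact: Sr.
    move=> i; rewrite mxE -intr_norm -natr_absz ler_pdivlMr // -natrM ler_nat ltnW //.
    exact: comb_le ME NP lc lastP i.
  have clb2 : `|sg * aff (intv R cl) x| <= (M ^ (size l).+1)%:R * dl.
    by rewrite normrM sg1 mul1r (le_trans clb) // mulrAC -mulrA ler_pM2l.
  rewrite -(ler_pM2l M0); move: clb2; rewrite ler_norml => /andP[].
  rewrite -[(_%:Z)%:~R]/((M ^ (size l).+1)%:R) in H *.
  by move: H; rewrite mulrCA; lra.
- move=> x Sx; rewrite aff_intvZ -sgE => pth; apply: SO => //.
  rewrite tail // mulrDr mulrCA.
  have : `|sg * aff (u - la *: intv R p) x| <= la / N%:R * (r + 1).
    by rewrite normrM sg1 mul1r; apply: aff_le; last exact: Sr.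
  rewrite ler_norml => /andP[_ h1].
  have h2 : la * (sg * aff (intv R p) x) <= la * - th by rewrite ler_pM2l.
  have h3 : Lam * (th - (r + 1) / N%:R) <= la * (th - (r + 1) / N%:R).
    by rewrite ler_wpM2r.
  have -> : - c = - c + la * (th - (r + 1) / N%:R) - la * (th - (r + 1) / N%:R) by ring.
  have h4 : la / N%:R * (r + 1) = la * ((r + 1) / N%:R) by rewrite mulrAC mulrA.
  rewrite h4 in h1; move: h1 h2 h3 cLam; rewrite !mulrBr !mulrN.
  move: (la * ((r + 1) / N%:R)) (la * th) (Lam * th) (Lam * ((r + 1) / N%:R)).
  move: (la * (sg * _)) (sg * _) => *; lra.
- have p0 x : aff (intv R (sz *: p)) x = 0 -> aff (intv R p) x = 0.
    rewrite aff_intvZ -sgE => /eqP; rewrite mulf_eq0 -normr_eq0 sg1 oner_eq0 /=.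
    by move/eqP.
  (* Where [p] vanishes, subtracting a multiple of it changes neither form, so the floor in [v] and
     the exact [la] in [u] still agree there. *)
  apply: (IH _ (u - la *: intv R p) (v - Num.floor la *: p)) => //.
  + by move=> x [Sx _]; apply: Sr.
  + move=> x [Sx /= /p0 px]; have := Sc x Sx.
    by rewrite aff_intvD aff_intvZ px mulr0 add0r.
  + move=> x [Sx /= /p0 px].
    by rewrite aff_intvB aff_intvZ px mulr0 subr0 uv // tail // px mulr0 add0r.
  + move=> x [Sx /= /p0 px] h; apply: SO => //.
    by rewrite tail // px mulr0 add0r.
Qed.

(** * Emptying the leaf regions by cuts *)

Lemma aff_iform (R : realType) (n : nat) (g : 'rV[int]_(n + 1)) (x : 'rV[R]_n) :
  aff (intv R g) x = iform (lsubmx g) x - (g 0 (rshift n 0))%:~R.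
Proof.
rewrite -[in LHS](hsubmxK g) map_row_mx aff_row !mxE; congr (_ - _).
by apply: eq_bigr => i _; rewrite !mxE.
Qed.

Lemma aff_sum (R : realType) (n : nat) (I : finType) (A : {set I}) (c : I -> R)
    (x : I -> 'rV[R]_n) (v : 'rV[R]_(n + 1)) :
  \sum_(i in A) c i = 1 ->
  aff v (\sum_(i in A) c i *: x i) = \sum_(i in A) c i * aff v (x i).
Proof.
move=> c1; rewrite /aff; under [RHS]eq_bigr do rewrite mulr_sumr.
rewrite exchange_big /=; apply: eq_bigr => j _.
have -> : hom (\sum_(i in A) c i *: x i) 0 j = \sum_(i in A) c i * hom (x i) 0 j.
  case: (split_ordP j) => k ->.
    rewrite row_mxEl summxE; apply: eq_bigr => i _.
    by rewrite row_mxEl mxE.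
  rewrite row_mxEr mxE -c1 -sumrN; apply: eq_bigr => i _.
  by rewrite row_mxEr mxE mulrN1.
by rewrite mulr_sumr; apply: eq_bigr => i _; rewrite mulrCA.
Qed.

(* If every form at the head of a list reached -1 at some point of [S], then averaging
   n + 1 of these points would make all the corresponding forms at most [-th]
   simultaneously, and Helly's theorem would yield a point in all the [O e]. *)
Lemma helly_lex (R : realType) (n P : nat) (dl th : R) (I : finType)
    (gs : I -> seq 'rV[int]_(n + 1)) (S : set 'rV[R]_n) (O : I -> set 'rV[R]_n) :
  0 <= dl -> 0 <= th -> n.+1%:R * th + n%:R * dl <= 1 ->
  convexK S -> (forall e, convexK (O e)) ->
  (forall e, lex_implies P dl th (gs e) S (O e)) ->
  S !=set0 -> (forall x, S x -> ~ forall e, O e x) ->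
  exists e g gs', gs e = g :: gs' /\ forall x, S x -> -1 < aff (intv R g) x.
Proof.
move=> dl0 th0 thdl cvS cvO lex [x0 Sx0] Oe; apply: contrapT => nex.
have /choice [y yP] e : exists x, S x /\
    forall g gs', gs e = g :: gs' -> aff (intv R g) x <= -1.
  case E : (gs e) => [|g gs']; first by exists x0.
  apply: contrapT => nx; apply: nex; exists e, g, gs'; split=> // x Sx.
  rewrite ltNge; apply/negP => gx; apply: nx; exists x; split=> // _ _ [<- _].
  exact: gx.
have [||x xP] := @helly R n I (fun e => S `&` O e).
- by move=> e; apply: convexKI.
- move=> A Acard; have [->|[e0 e0A]] := set_0Vmem A.
    by exists 0 => i; rewrite inE.
  have A0 : (0 < #|A|)%N by apply/card_gt0P; exists e0.
  have A0R : 0 < #|A|%:R :> R by rewrite ltr0n.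
  pose c (i : I) : R := #|A|%:R^-1.
  have c1 : \sum_(i in A) c i = 1.
    by rewrite sumr_const -[LHS]mulr_natl mulfV // gt_eqF.
  have Sx : S (\sum_(i in A) c i *: y i).
    have := @convexK_sum R n S I c y (enum A) cvS.
    rewrite !big_enum /= c1 invr1 scale1r; apply=> // i _.
      by rewrite invr_ge0 ltW.
    by move=> _; case: (yP i).
  exists (\sum_(i in A) c i *: y i) => e eA; split=> //.
  have := lex e; case E : (gs e) => [|g gs'] /=; first exact.
  case=> _ gdl gth _; apply: gth => //; rewrite aff_sum //.
  have [Sye gye] := yP e; have {}gye := gye _ _ E.
  rewrite -mulr_sumr -(ler_pM2l A0R) mulrA mulfV ?mul1r ?gt_eqF //.
  (* The point of [e] contributes at most -1 and the at most n others [dl] each; the total is at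
     most [n * dl - 1 <= - (n + 1) * th]. *)
  rewrite (bigD1 e) //=.
  have : \sum_(i in A | i != e) aff (intv R g) (y i) <= \sum_(i in A | i != e) dl.
    by apply: ler_sum => i _; apply: gdl; case: (yP i).
  have -> : \sum_(i in A | i != e) dl = #|A|.-1%:R * dl.
    rewrite sumr_const mulr_natl (cardsD1 e A) eA; congr (_ *+ _).
    by apply: eq_card => i; rewrite !inE andbC.
  have : #|A|.-1%:R * dl <= n%:R * dl.
    by rewrite ler_wpM2r // ler_nat; case: #|A| Acard.
  have : #|A|%:R * th <= n.+1%:R * th by rewrite ler_wpM2r // ler_nat.
  by rewrite mulrN; lra.
(* For empty [I], [x] need not lie in [S]; starting from [x0] supplies an index [e] before [xP] is
   used. *)
- by apply: (Oe x0 Sx0) => e; exfalso; case: (xP e) => Sx _; apply: (Oe x Sx) => e';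
    case: (xP e').
Qed.

Definition labels_le (n X : nat) (T : btree n) : bool :=
  all (fun e : 'rV[int]_n * int =>
         [forall i, (`|e.1 ord0 i| <= X)%N] && (`|e.2| <= X)%N) (edge_labels T).

Lemma labels_le_Node (n X : nat) (a : 'rV[int]_n) (b : int) (l r : btree n) :
  (forall i, (`|a ord0 i| <= X)%N) -> (`|b|.+1 <= X)%N ->
  labels_le X l -> labels_le X r -> labels_le X (Node a b l r).
Proof.
move=> aX bX lX rX; rewrite /labels_le /= all_cat; apply/and3P; split.
- by apply/andP; split; [apply/forallP|apply: ltnW].
- apply/andP; split; last by lia.
  by apply/forallP => i; rewrite mxE abszN.
- by apply/andP; split.
Qed.

(** Once leading forms vanishing on all of [S] are dropped, a head [g] is nonzero somewhere on [S],
    which makes [g = 0] independent of the equalities already holding. *)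
Lemma lex_strip (R : realType) (n P : nat) (dl th : R) (gs : seq 'rV[int]_(n + 1))
    (S O : set 'rV[R]_n) : lex_implies P dl th gs S O ->
  exists2 gs', lex_implies P dl th gs' S O & forall g gs'', gs' = g :: gs'' ->
    exists2 x, S x & aff (intv R g) x != 0.
Proof.
elim: gs => [|g gs IH] /=; first by exists [::].
have [[x Sx gx] gl|ng [_ _ _ gl]] := pselect (exists2 x, S x & aff (intv R g) x != 0).
  by exists (g :: gs) => // _ _ [<- _]; exists x.
apply: IH; apply: lex_implies_sub gl => x Sx; split=> //=.
by apply/eqP/negP => /negP gx; apply: ng; exists x.
Qed.

(** The last entry of [hom x] is -1, so [hom x] is nonzero and the forms vanishing at [x] make up a
    proper subspace. *)
Lemma rank_lt_hom (R : realType) (n : nat) (A : 'M[R]_(n + 1)) (x : 'rV[R]_n) :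
  (A <= kermx (hom x)^T)%MS -> (\rank A < n + 1)%N.
Proof.
move=> /mxrankS; rewrite mxrank_ker => /leq_ltn_trans; apply.
rewrite ltn_subrL addn_gt0 orbT andbT lt0n mxrank_eq0; apply/negP => /eqP.
move/matrixP => /(_ (rshift n 0) 0).
rewrite [LHS]mxE [RHS]mxE row_mxEr mxE => /eqP.
by rewrite oppr_eq0 oner_eq0.
Qed.

(* [m] bounds the codimension in homogeneous coordinates of the equalities collected in
   [A]; each pair of cuts [g <= 0], [g >= 0] adds one independent equality. *)
Lemma fix_leaf (R : realType) (n P : nat) (dl th : R) (I : finType)
    (gs : I -> seq 'rV[int]_(n + 1)) (S : set 'rV[R]_n) (O : I -> set 'rV[R]_n)
    (A : 'M[R]_(n + 1)) (m : nat) :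
  0 <= dl -> dl < 1 -> 0 <= th -> n.+1%:R * th + n%:R * dl <= 1 ->
  convexK S -> (forall e, convexK (O e)) ->
  (forall e, lex_implies P dl th (gs e) S (O e)) ->
  (forall x, S x -> ~ forall e, O e x) ->
  (forall x, S x -> (A <= kermx (hom x)^T)%MS) -> (n + 1 <= \rank A + m)%N ->
  exists T : btree n, [/\ valid S T, (nnodes T <= 4 * m + 1)%N & labels_le P.+2 T].
Proof.
move=> dl0 dl1 th0 thdl + cvO.
elim: m S A gs => [|m IH] S A gs cvS lex Oe Aker Am;
  have [S0|/set0P S0] := eqVneq S set0; do ?by exists Leaf; split=> //; lia.
  (* For [m = 0] the rank of [A] would be n + 1, which a point of [S] forbids. *)
  have [x0 Sx0] := S0.
  by have := rank_lt_hom (Aker x0 Sx0); rewrite ltnNge -[\rank A]addn0 Am.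
have /choice [gs2 gs2P] e := (let: ex_intro2 g a b := lex_strip (lex e) in
  ex_intro (fun g => lex_implies P dl th g S (O e) /\ forall h t, g = h :: t ->
    exists2 x, S x & aff (intv R h) x != 0) g (conj a b)).
have [|e [g [gs' [Ee gm1]]]] := @helly_lex R n P dl th I gs2 S O dl0 th0 thdl cvS cvO _ S0 Oe.
  by move=> e; case: (gs2P e).
have [lexe /(_ _ _ Ee) [x1 Sx1 gx1]] := gs2P e.
move: lexe; rewrite Ee /= => -[gP gdl _ _].
pose S' := S `&` [set x | aff (intv R g) x = 0].
have SS' : S' `<=` S by move=> x [].
have S'g : S' = S `&` [set x | aff (intv R g) x <= 0] `&` [set x | aff (intv R (- g)) x <= 0].
  have E x : aff (intv R (- g)) x = - aff (intv R g) x.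
    by rewrite -scaleN1r aff_intvZ mulN1r.
  apply/seteqP; split=> x /=.
    by move=> [Sx /= gx]; rewrite /= E gx oppr0 lexx.
  by rewrite E oppr_le0 => -[[Sx g1] g2]; split=> //=; apply/eqP; rewrite eq_le g1.
have [|||||T [vT nT lT]] := IH S' (A + intv R g)%MS gs2.
- by rewrite S'g; apply: convexKI; [apply: convexKI|]=> //; apply: convexK_aff.
- by move=> e'; apply: lex_implies_sub SS' _; case: (gs2P e').
- by move=> x /SS'; apply: Oe.
- move=> x S'x; rewrite addsmx_sub (Aker _ (SS' _ S'x)) andTb; apply/sub_kermxP.
  apply/matrixP => i j; rewrite !ord1 [RHS]mxE; case: S'x => _ /= gx.
  rewrite -[RHS]gx [LHS]mxE /aff; apply: eq_bigr => k _.
  by rewrite [(hom x)^T _ _]mxE.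
- apply: leq_trans Am _; rewrite addnS -addSn leq_add2r.
  apply: rank_ltmx; rewrite ltmxE addsmxSl /=.
  (* A [g] in the row span of [A] would vanish at [x1]. *)
  apply: contra gx1 => /(submx_trans (addsmxSr _ _)) gA.
  have /sub_kermxP := submx_trans gA (Aker x1 Sx1).
  move/matrixP => /(_ 0 0); rewrite [LHS]mxE [RHS]mxE => gx; apply/eqP.
  rewrite -[RHS]gx /aff; apply: eq_bigr => k _.
  by rewrite [(hom x1)^T _ _]mxE.
set a := lsubmx g; set b := g 0 (rshift n 0).
have gE x : aff (intv R g) x = iform a x - b%:~R by apply: aff_iform.
(* Both leaves are empty since [-1 < g < 1] on [S]: the two queries are Chvatal-Gomory cuts. *)
exists (Node a b (Node a (b - 1) Leaf T) Leaf); split=> /=.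
- split; last first.
    apply/seteqP; split=> // x [Sx /=]; have := gdl x Sx.
    by rewrite gE intrB intrN; lra.
  split.
    apply/seteqP; split=> // x [[Sx /= _]]; have := gm1 x Sx.
    by rewrite gE intrB; lra.
  suff -> : S `&` [set x | iform a x <= b%:~R]
     `&` [set x | - iform a x <= (- (b - 1) - 1)%:~R] = S' by [].
  apply/seteqP; split=> x /=; rewrite /S' /= gE.
    by rewrite intrB intrN intrB; case=> -[Sx h1] h2; split=> //; lra.
  by case=> Sx h; rewrite intrB intrN intrB; split; first split=> //; lra.
- by lia.
- have aP i : (`|a ord0 i| <= P)%N by rewrite mxE; apply: gP.
  have bP : (`|b| <= P)%N by apply: gP.
  apply: labels_le_Node => [i|||//]; [by rewrite !leqW|lia|].
  by apply: labels_le_Node => [i|||//]; [rewrite !leqW|lia|].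
Qed.

(** * Replacing a single query *)

(** The left side is [K * P] in [approx], so [M <= Y ^ (n + 2)]; at most n + 1 approximants then
    keep the query below [Y ^ ((n + 2) ^ 2)]. *)
Lemma weight_le (n Rb : nat) : (0 < n)%N -> (0 < Rb)%N ->
  ((4 * n * Rb.+1) * (5 * n.+1 * (8 * n * Rb) ^ n) < (10 * n * Rb) ^ (n + 2))%N.
Proof.
move=> n0 Rb0.
have h1 : (4 * n * Rb.+1 <= 8 * (n * Rb))%N by nia.
have h2 : (5 * n.+1 <= 10 * (n * Rb))%N by nia.
rewrite -!mulnA expnD.
have : (0 < n * Rb)%N by rewrite muln_gt0 n0.
have h3 : ((8 * (n * Rb)) ^ n <= (10 * (n * Rb)) ^ n)%N by rewrite leq_exp2r // leq_mul.
have h4 : (0 < (10 * (n * Rb)) ^ n)%N by rewrite expn_gt0 !muln_gt0 n0 Rb0.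
move: h1 h2 h3 h4; rewrite -!mulnA; set t := (n * Rb)%N => h1 h2 h3 h4 t0.
have := leq_mul (leq_mul h1 h2) h3; rewrite -!mulnA => /leq_ltn_trans; apply.
move: ((10 * t) ^ n)%N h4 => z z0; rewrite expnS expn1; nia.
Qed.

Lemma approx (R : realType) (n Rb : nat) (a : 'rV[int]_n) (b : int) :
  (0 < n)%N -> (0 < Rb)%N ->
  let Y := (10 * n * Rb)%N in
  let P := (5 * n.+1 * (8 * n * Rb) ^ n)%N in
  let dl := (4 * n)%:R^-1 : R in let th := 3 / (4 * n.+1)%:R : R in
  let B := [set x : 'rV[R]_n | l1norm x <= Rb%:R] in
  exists (a' : 'rV[int]_n) (b' : int) (gl gr : seq 'rV[int]_(n + 1)),
    [/\ forall i, (`|a' ord0 i| < Y ^ ((n + 2) ^ 2))%N, (`|b'| < Y ^ ((n + 2) ^ 2))%N,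
        lex_implies P dl th gl (B `&` [set x | iform a' x <= b'%:~R])
          [set x | iform a x <= b%:~R]
      & lex_implies P dl th gr (B `&` [set x | - iform a' x <= (- b' - 1)%:~R])
          [set x | - iform a x <= (- b - 1)%:~R]].
Proof.
move=> n0 Rb0 Y P dl th B.
(* Here [th = 3 / Lam] and [(Rb + 1) / N <= 2 / Lam], which leaves the margin [1 / Lam] needed for
   [c = 1]. Also [(Rb + 1) / K = dl], [P = (Lam + n + 1) * N ^ n] is the bound of [red_le], and
   [(n + 1) * th + n * dl = 1] suits [helly_lex]. *)
pose N := (8 * n * Rb)%N; pose Lam : R := (4 * n.+1)%:R.
pose K := (4 * n * Rb.+1)%N; pose M := (K * P).+1.
pose v : 'rV[int]_(n + 1) := row_mx a (const_mx b).
have N0 : (0 < N)%N by rewrite !muln_gt0 n0 Rb0.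
have K0 : (0 < K)%N by rewrite !muln_gt0 n0.
have Lam0 : 0 < Lam by rewrite ltr0n.
have [|l ls lc] := @ex_chain R (n + 1) N Lam (n + 1) (intv R v) N0 Lam0.
  by apply: leq_trans (max_card _) _; rewrite card_ord.
have n1 : (n + 1).-1 = n by rewrite addn1.
have NP : (N ^ (n + 1).-1 <= P)%N by rewrite n1 leq_pmull.
have lastP i : (`|red v l ord0 i| <= P)%N.
  have := @red_le R (n + 1) N Lam 0 l (intv R v) v _ lc i.
  rewrite -intr_norm -natr_absz addr0 n1 /Lam -natrD -natrM ler_nat => h.
  apply: leq_trans (h _) _; first by move=> j; rewrite subrr mxE normr0 mul0r.
  by rewrite leq_mul2r; apply/orP; right; lia.
have MY : (M <= Y ^ (n + 2))%N by apply: weight_le.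
pose w := comb M l (red v l).
have wY i : (`|w ord0 i| < Y ^ ((n + 2) ^ 2))%N.
  have h := comb_le (erefl M) NP lc lastP i.
  apply: (@leq_ltn_trans (`|w ord0 i| * K)); first by rewrite leq_pmulr.
  apply: leq_trans h _; rewrite [((n + 2) ^ 2)%N]expnS expn1 expnM.
  apply: (@leq_trans (M ^ (n + 2))); first by rewrite leq_pexp2l //; lia.
  by rewrite leq_exp2r //; lia.
have nR : 0 < n%:R :> R by rewrite ltr0n.
have nR1 : 1 <= n%:R :> R by rewrite ler1n.
have RR1 : 1 <= Rb%:R :> R by rewrite ler1n.
have dlE : (Rb%:R + 1) / K%:R <= dl.
  rewrite /K /dl !natrM -[Rb.+1%:R]natr1 ler_pdivrMr; last by rewrite !mulr_gt0 //; lra.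
  by rewrite mulrA mulVf ?mul1r //; rewrite gt_eqF // mulr_gt0.
have thN : Lam^-1 <= th - (Rb%:R + 1) / N%:R.
  suff : (Rb%:R + 1) / N%:R <= 2 * Lam^-1 by rewrite /th -/Lam; move: Lam^-1 (_ / N%:R) => p q; lra.
  rewrite /Lam ler_pdivrMr ?ltr0n // mulrAC ler_pdivlMr ?ltr0n //.
  by rewrite natr1 -!natrM ler_nat /N; nia.
have thN0 : 0 <= th - (Rb%:R + 1) / N%:R by apply: le_trans thN; rewrite invr_ge0 ltW.
have thN1 : 1 <= Lam * (th - (Rb%:R + 1) / N%:R).
  by rewrite -ler_pdivrMl // mulr1.
have wE (x : 'rV[R]_n) : aff (intv R w) x = iform (lsubmx w) x - (w 0 (rshift n 0))%:~R.
  exact: aff_iform.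
have vE (x : 'rV[R]_n) : aff (intv R v) x = iform a x - b%:~R.
  by rewrite aff_iform row_mxKl row_mxEr mxE.
exists (lsubmx w), (w 0 (rshift n 0)), [seq 1 *: e.2 | e <- l], [seq -1 *: e.2 | e <- l].
split; [by move=> i; rewrite mxE|exact: wY| |].
- apply: (@comb_lex R n N M K P Lam dl th Rb%:R 1 0 1 _ _ l (intv R v) v) => //.
  + by rewrite mulr_ge0 // ltW.
  + by move=> x [].
  + by move=> x [_ /=]; rewrite -/w wE; lra.
  + by move=> x _; rewrite vE /=; lra.
- apply: (@comb_lex R n N M K P Lam dl th Rb%:R (-1) 1 (-1) _ _ l (intv R v) v) => //.
  + by move=> x [].
  + by move=> x [_ /=]; rewrite -/w wE intrB intrN; lra.
  + by move=> x _; rewrite vE /= intrB intrN; lra.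
Qed.

(** * Bit-sizes *)

Lemma bits_ineq_le (n X w : nat) (a : 'rV[int]_n) (b : int) :
  (up_log 2 X.+1 <= w)%N -> (forall i, (`|a ord0 i| <= X)%N) -> (`|b| <= X)%N ->
  (bits_ineq a b <= n + n.+1 * (w + 2))%N.
Proof.
move=> Xw aX bX.
have bi z : (`|z| <= X)%N -> (bits_int z <= w + 2)%N.
  move=> zX; rewrite /bits_int (up_lognn (isT : (1 < 2)%N)).
  have : (up_log 2 (`|z| + 1) <= w)%N.
    by apply: leq_trans Xw; apply: leq_up_log; rewrite addn1.
  lia.
rewrite /bits_ineq /bits_vec -addnA leq_add2l mulSn addnC leq_add ?bi //.
apply: (@leq_trans (\sum_(i < n) (w + 2))); first by apply: leq_sum => i _; apply: bi.
by rewrite sum_nat_const card_ord.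
Qed.

(** The inner factor 3 counts the label of a node and those of its two edges. *)
Lemma tbits_le (n X w : nat) (T : btree n) :
  (up_log 2 X.+1 <= w)%N -> labels_le X T ->
  (tbits T <= nnodes T * (3 + 3 * (n + n.+1 * (w + 2))))%N.
Proof.
move=> Xw; elim: T => [|a b l IHl r IHr]; first by rewrite mul1n.
rewrite /labels_le /= all_cat => /and3P[/andP[/forallP aX bX] /andP[/forallP aX' bX']].
move=> /andP[/IHl lP /IHr rP].
have := bits_ineq_le Xw aX bX; have := bits_ineq_le Xw aX' bX'.
move: lP rP; set W := (n + _)%N; move: (bits_ineq a b) (bits_ineq (- a) _) => p q.
nia.
Qed.

(** * Rebuilding the whole tree *)

Lemma convexK_iform (R : realType) (n : nat) (a : 'rV[int]_n) (c : R) :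
  convexK [set x : 'rV[R]_n | iform a x <= c].
Proof.
have E (x : 'rV[R]_n) : iform a x = aff (row_mx (intv R a) 0) x.
  by rewrite aff_row mxE subr0; apply: eq_bigr => i _; rewrite mxE.
by under eq_set do rewrite E; apply: convexK_aff.
Qed.

Lemma convexK_iformN (R : realType) (n : nat) (a : 'rV[int]_n) (c : R) :
  convexK [set x : 'rV[R]_n | - iform a x <= c].
Proof.
have E (x : 'rV[R]_n) : - iform a x = iform (- a) x.
  by rewrite /iform -sumrN; apply: eq_bigr => i _; rewrite mxE intrN mulNr.
by under eq_set do rewrite E; apply: convexK_iform.
Qed.

(* [O] lists the half-spaces of the original branch; the corresponding branch of the new
   tree only implies them lexicographically. *)
Lemma rebuild (R : realType) (n Rb : nat) (T : btree n) :
  (0 < n)%N -> (0 < Rb)%N ->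
  let Y := (10 * n * Rb)%N in
  let P := (5 * n.+1 * (8 * n * Rb) ^ n)%N in
  forall (I : finType) (gs : I -> seq 'rV[int]_(n + 1)) (S K : set 'rV[R]_n)
    (O : I -> set 'rV[R]_n),
  convexK S -> (forall x, S x -> l1norm x <= Rb%:R) -> (forall e, convexK (O e)) ->
  (forall e, lex_implies P (4 * n)%:R^-1 (3 / (4 * n.+1)%:R) (gs e) S (O e)) ->
  (forall x, S x -> (forall e, O e x) -> K x) -> valid K T ->
  exists T' : btree n,
    [/\ valid S T', (nnodes T' <= 9 * n * nnodes T)%N,
        labels_le (Y ^ ((n + 2) ^ 2)) T'
      & (tbits T' <= 400 * n ^ 3 * up_log 2 Y * nnodes T)%N].
Proof.
move=> n0 Rb0 Y P.
have Y10 : (10 <= Y)%N by rewrite /Y -mulnA leq_pmulr // muln_gt0 n0.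
pose t := up_log 2 Y.
have t0 : (0 < t)%N by rewrite up_log_gt0 /= (leq_trans _ Y10).
have logY e X : (X <= Y ^ e)%N -> (up_log 2 X.+1 <= t * e + 1)%N.
  move=> XY; apply: up_log_min => //.
  have : (Y ^ e <= 2 ^ (t * e))%N by rewrite expnM; case: (e) => // k; rewrite leq_exp2r // up_logP.
  have : (0 < 2 ^ (t * e))%N by rewrite expn_gt0.
  by rewrite addn1 expnS; lia.
elim: T => [|a b l IHl r IHr] I gs S K O cvS Sball cvO lex SK /=.
  move=> K0.
  have n4 : (0 : R) < (4 * n)%:R by rewrite ltr0n muln_gt0.
  have n14 : (0 : R) < (4 * n.+1)%:R by rewrite ltr0n.
  (* No equality is known yet: [A = 0] and [m = n + 1], giving at most [4 * n + 5 <= 9 * n]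
     nodes. *)
  have [|||||||T [vT nT lT]] := @fix_leaf R n P (4 * n)%:R^-1 (3 / (4 * n.+1)%:R) I gs S O
      0 (n + 1) _ _ _ _ cvS cvO lex.
  - by rewrite invr_ge0 ltW.
  - by rewrite invf_lt1 // ltr1n; lia.
  - by rewrite divr_ge0 // ltW.
  - rewrite !natrM; have : n.+1%:R != 0 :> R by rewrite pnatr_eq0.
    have : n%:R != 0 :> R by rewrite pnatr_eq0 -lt0n.
    move: n.+1%:R n%:R => p q q0 p0; suff -> : p * (3 / (4 * p)) + q * (4 * q)^-1 = 1 :> R by [].
    by field; rewrite q0 p0.
  - by move=> x Sx Ox; have := SK x Sx Ox; rewrite K0.
  - by move=> x _; apply: sub0mx.
  - by rewrite mxrank0.
  (* The cuts obey this much smaller bound, so O(n) of them with O(n^2 log Y) bits each stay within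
     the cubic budget; the larger exponent would cost a factor n more. *)
  have PY : (P.+2 <= Y ^ (n + 2))%N.
    apply: leq_trans (weight_le n0 Rb0); rewrite ltnS -/P.
    have : (0 < P)%N by rewrite !muln_gt0 expn_gt0 !muln_gt0 n0 Rb0.
    have : (8 <= 4 * n * Rb.+1)%N by nia.
    by move: (4 * n * Rb.+1)%N => k; nia.
  exists T; split=> //; first by apply: leq_trans nT _; lia.
    have PX : (P.+2 <= Y ^ ((n + 2) ^ 2))%N.
      by apply: leq_trans PY _; rewrite leq_pexp2l //; nia.
    apply: sub_all lT => -[c d] /andP[/forallP cP dP]; apply/andP; split.
      by apply/forallP => i; apply: leq_trans (cP i) PX.
    exact: leq_trans dP PX.
  apply: leq_trans (tbits_le (logY _ _ PY) lT) _.
  have w1 : (t * (n + 2) + 1 + 2 <= 6 * n * t)%N by nia.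
  have w2 : (n + n.+1 * (t * (n + 2) + 1 + 2) <= 13 * n ^ 2 * t)%N.
    have : (n.+1 * (t * (n + 2) + 1 + 2) <= 2 * n * (6 * n * t))%N by rewrite leq_mul //; lia.
    by rewrite expnS expn1; nia.
  have w3 : (3 + 3 * (n + n.+1 * (t * (n + 2) + 1 + 2)) <= 42 * n ^ 2 * t)%N.
    have : (0 < n ^ 2 * t)%N by rewrite muln_gt0 expn_gt0 n0.
    move: w2; rewrite -!mulnA; move: (n ^ 2 * t)%N (n + _)%N => p q; lia.
  apply: (@leq_trans (9 * n * (42 * n ^ 2 * t))).
    by apply: leq_mul w3; apply: leq_trans nT _; lia.
  rewrite muln1 [(n ^ 3)%N]expnS -/t; move: (n ^ 2)%N => p; nia.
move=> [vl vr].
have [a' [b' [gl [gr [aY bY lexl lexr]]]]] := approx R a b n0 Rb0.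
have SB (H : set 'rV[R]_n) :
    S `&` H `<=` [set x : 'rV[R]_n | l1norm x <= Rb%:R] `&` H.
  by move=> x [Sx Hx]; split=> //; apply: Sball.
(* [None] indexes the new half-space; the earlier ones keep their lists on the smaller region. *)
have [|||||l' [vl' nl' ll' bl']] := IHl (option I) (fun e => oapp gs gl e)
    (S `&` [set x | iform a' x <= b'%:~R]) (K `&` [set x | iform a x <= b%:~R])
    (fun e => oapp O [set x | iform a x <= b%:~R] e) _ _ _ _ _ vl.
- by apply: convexKI => //; apply: convexK_iform.
- by move=> x [/Sball].
- by case=> [e|] /=; [apply: cvO|apply: convexK_iform].
- case=> [e|] /=; first by apply: lex_implies_sub (lex e) => x [].
  by apply: lex_implies_sub lexl; apply: SB.
- move=> x [Sx _] Ox; split; last exact: (Ox None).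
  by apply: SK => // e; apply: (Ox (Some e)).
have [|||||r' [vr' nr' lr' br']] := IHr (option I) (fun e => oapp gs gr e)
    (S `&` [set x | - iform a' x <= (- b' - 1)%:~R])
    (K `&` [set x | - iform a x <= (- b - 1)%:~R])
    (fun e => oapp O [set x | - iform a x <= (- b - 1)%:~R] e) _ _ _ _ _ vr.
- by apply: convexKI => //; apply: convexK_iformN.
- by move=> x [/Sball].
- by case=> [e|] /=; [apply: cvO|apply: convexK_iformN].
- case=> [e|] /=; first by apply: lex_implies_sub (lex e) => x [].
  by apply: lex_implies_sub lexr; apply: SB.
- move=> x [Sx _] Ox; split; last exact: (Ox None).
  by apply: SK => // e; apply: (Ox (Some e)).
exists (Node a' b' l' r'); split=> //=.
- by rewrite mulnS mulnDr; move: nl' nr'; lia.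
- by apply: labels_le_Node => // i; apply: ltnW.
set X := (Y ^ ((n + 2) ^ 2))%N in aY bY.
have hX := logY _ _ (leqnn X).
have /(bits_ineq_le hX) : forall i, (`|a' ord0 i| <= X)%N by move=> i; apply: ltnW.
move=> /(_ b' (ltnW bY)).
have /(bits_ineq_le hX) : forall i, (`|(- a') ord0 i| <= X)%N.
  by move=> i; rewrite mxE abszN; apply: ltnW.
have bN : (`|(- b' - 1)%R| <= X)%N by lia.
move=> /(_ _ bN).
have w1 : (t * (n + 2) ^ 2 + 1 + 2 <= 12 * n ^ 2 * t)%N.
  have : ((n + 2) ^ 2 <= 9 * n ^ 2)%N by rewrite !expnS !expn0; nia.
  have : (0 < n ^ 2)%N by rewrite expn_gt0 n0.
  by move: (n ^ 2)%N ((n + 2) ^ 2)%N => p q; nia.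
have w2 : (n + n.+1 * (t * (n + 2) ^ 2 + 1 + 2) <= 25 * n ^ 3 * t)%N.
  have : (n.+1 * (t * (n + 2) ^ 2 + 1 + 2) <= 2 * n * (12 * n ^ 2 * t))%N.
    by rewrite leq_mul //; lia.
  have : (0 < n ^ 2)%N by rewrite expn_gt0 n0.
  by rewrite [(n ^ 3)%N]expnS; move: (n ^ 2)%N (_ * (_ + 2))%N => p q; nia.
have E k : (400 * n ^ 3 * t * k = 400 * (n ^ 3 * t * k))%N by rewrite !mulnA.
have z0 : (0 < n ^ 3 * t)%N by rewrite muln_gt0 expn_gt0 n0.
move: bl' br' w2; rewrite -/t !E -[(25 * _ * _)%N]mulnA mulnS mulnDr.
move: (n ^ 3 * t)%N z0 => z; lia.
Qed.

Theorem theorem1p1 :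
  exists C D : nat, forall (R : realType) (n Rb : nat),
    (0 < n)%N -> (0 < Rb)%N ->
    forall K : set 'rV[R]_n,
      compact K -> convexK K ->
      (forall x, K x -> l1norm x <= Rb%:R) ->
      forall T : btree n, valid K T ->
      exists T' : btree n,
        [/\ valid K T',
            (nnodes T' <= C * n * nnodes T)%N,
            all (fun e : 'rV[int]_n * int =>
                   [forall i, (`|e.1 ord0 i| <= (10 * n * Rb) ^ ((n + 2) ^ 2))%N]
                   && (`|e.2| <= (10 * n * Rb) ^ ((n + 2) ^ 2))%N)
                (edge_labels T')
          & (tbits T')%:R <= D%:R * (n%:R ^+ 3) * log2R (2 * n * Rb)%:R
                                * (nnodes T)%:R :> R].
Proof.
exists 9, 2000 => R n Rb n0 Rb0 K _ cvK Kball T vT.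
(* At the root no half-space has been collected, hence the empty index type. *)
have [|||T' [vT' nT' lT' bT']] := @rebuild R n Rb T n0 Rb0 void
  (fun _ => [::]) K K (fun _ => setT) cvK Kball _ _ _ vT; try by case.
exists T'; split=> //.
have l2 : 0 < ln 2 :> R by rewrite ln_gt0 // ltr1n.
have tlog : (up_log 2 (10 * n * Rb))%:R <= 5 * log2R (2 * n * Rb)%:R :> R.
  have nRb : (0 < n * Rb)%N by rewrite muln_gt0 n0.
  rewrite /log2R -!mulnA; set s := (n * Rb)%N in nRb *.
  set t := up_log 2 (10 * s).
  have tgt : (2 ^ t.-1 < 10 * s)%N by apply: up_log_gtn => //; lia.
  have t0 : (0 < t)%N by rewrite up_log_gt0 /=; lia.
  (* Rounding the logarithm up costs a factor 2: [2 ^ t <= 20 s <= (2 s) ^ 5]. This gives the factor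
     5, and 2000 is 400 times 5. *)
  have h : (2 ^ t <= (2 * s) ^ 5)%N.
    rewrite -(prednK t0) expnS; apply: (@leq_trans (2 * (10 * s))); first by lia.
    have : (0 < s ^ 4)%N by rewrite expn_gt0 nRb.
    by rewrite expnMn [(s ^ 5)%N]expnS; move: (s ^ 4)%N => p; nia.
  rewrite mulrA ler_pdivlMr // -[5]/(5%:R) !mulr_natl -!lnXn ?ltr0n //; last by lia.
  by rewrite ler_ln ?posrE ?exprn_gt0 ?ltr0n //; [rewrite -!natrX ler_nat|lia].
apply: (@le_trans _ _ (400 * n ^ 3 * up_log 2 (10 * n * Rb) * nnodes T)%:R).
  by rewrite ler_nat.
rewrite natrM ler_wpM2r // natrM (natrM _ 400) natrX.
apply: (@le_trans _ _ (400 * n%:R ^+ 3 * (5 * log2R (2 * n * Rb)%:R))).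
  apply: ler_wpM2l tlog; apply: mulr_ge0; first exact: ler0n.
  exact/exprn_ge0/ler0n.
by rewrite le_eqVlt; apply/orP; left; apply/eqP; rewrite !natrM; ring.
Qed.
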